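(* Let $r$ be a nonnegative integer. For all integers $n,k\geq 0$, we have $$\frac{1}{k!}\left(\delta^k r^n\right)=\begin{cases}T_r(n+r,k+r), & \text{if } n\geq k,\\ 0, & \text{if } n<k,\end{cases}$$ where $\delta^k r^n$ denotes the value at $x=r$ of $\delta^k f$ for the function $f(x)=x^n$.
   Context: The central difference operator $\delta$ acts on functions $f$ of a real variable by $\delta f(x)=f\left(x+\frac12\right)-f\left(x-\frac12\right)$; $\delta^k$ is its $k$-fold iterate ($\delta^0$ being the identity). For a nonnegative integer $r$, the extended $r$-central factorial numbers of the second kind $T_r(n+r,k+r)$ ($n\ge k\ge 0$) are defined by the formal power series identity $$\frac{1}{k!}e^{rt}\left(e^{t/2}-e^{-t/2}\right)^k=\sum_{n=k}^\infty T_r(n+r,k+r)\frac{t^n}{n!},\qquad k\ge 0.$$ Convention: $0^0=1$. *)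

(* Defs.v *)
From Stdlib Require Import Reals Lra Lia PeanoNat Factorial.
From Coquelicot Require Import Coquelicot.
Open Scope R_scope.

Definition central_diff (f : R -> R) : R -> R :=
  fun x => f (x + 1 / 2) - f (x - 1 / 2).

Definition central_diff_iter (k : nat) (f : R -> R) : R -> R :=
  Nat.iter k central_diff f.

(* A formal power series in t is its sequence of coefficients [nat -> R],
   added, scaled and multiplied by Coquelicot's [PS_plus], [PS_scal] and
   [PS_mult] (Cauchy product); no convergence is involved. *)

Definition PS_one : nat -> R := fun n => if n =? 0 then 1 else 0.

Definition PS_pow (a : nat -> R) (k : nat) : nat -> R :=
  Nat.iter k (PS_mult a) PS_one.

(* e^(c t); since [0 ^ 0 = 1], [PS_exp 0] is the series 1. *)
Definition PS_exp (c : R) : nat -> R := fun n => c ^ n / INR (fact n).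

(* (1/k!) e^(r t) (e^(t/2) - e^(-t/2))^k *)
Definition central_factorial2_egf (r k : nat) : nat -> R :=
  PS_scal (/ INR (fact k))
    (PS_mult (PS_exp (INR r))
             (PS_pow (PS_minus (PS_exp (1 / 2)) (PS_exp (- (1 / 2)))) k)).

(* [central_factorial2 r N K] is T_r(N, K), with the arguments N = n + r and
   K = k + r of the literature.  It is meaningful for N >= K >= r only; the
   truncated subtractions give junk values when N < r or K < r. *)
Definition central_factorial2 (r N K : nat) : R :=
  INR (fact (N - r)) * central_factorial2_egf r (K - r) (N - r).

Lemma sum_f_R0_eq0 (f : nat -> R) (n : nat) :
  (forall i, (i <= n)%nat -> f i = 0) -> sum_f_R0 f n = 0.
Proof.
induction n as [|n IH]; intros Hf; simpl.
- apply Hf; lia.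
- rewrite IH, (Hf (S n)); [lra | lia | intros; apply Hf; lia].
Qed.

Lemma PS_pow_low (a : nat -> R) (k n : nat) :
  a 0%nat = 0 -> (n < k)%nat -> PS_pow a k n = 0.
Proof.
intros Ha; revert n; induction k as [|k IH]; intros n Hn; [lia|].
change (PS_mult a (PS_pow a k) n = 0).
apply sum_f_R0_eq0; intros [|i] Hi.
- rewrite Ha; ring.
- rewrite IH; [ring | lia].
Qed.

(* The defining identity of the T_r(n + r, k + r): in particular the series on
   its left-hand side has no term of degree n < k. *)
Lemma central_factorial2_egfE (r k n : nat) :
  central_factorial2_egf r k n =
  if (k <=? n)%nat
  then central_factorial2 r (n + r) (k + r) / INR (fact n) else 0.
Proof.
destruct (Nat.leb_spec k n) as [Hkn|Hnk].
- unfold central_factorial2; rewrite !Nat.add_sub.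
  field; apply INR_fact_neq_0.
- unfold central_factorial2_egf, PS_scal.
  enough (H : PS_mult (PS_exp (INR r))
     (PS_pow (PS_minus (PS_exp (1 / 2)) (PS_exp (- (1 / 2)))) k) n = 0)
    by (rewrite H; exact (Rmult_0_r _)).
  apply sum_f_R0_eq0; intros i Hi.
  rewrite PS_pow_low; [ring | | lia].
  unfold PS_minus, PS_exp, plus, opp; simpl; lra.
Qed.

(* Main.v *)
(** The central difference in x of [e^(x t) P(t)] is
    [e^(x t) (e^(t/2) - e^(-t/2)) P(t)].  Hence, by induction on k, the k-th
    central difference of [x^n], which is n! times the coefficient of [t^n] in
    [e^(x t)], is n! times that of [e^(x t) (e^(t/2) - e^(-t/2))^k]; put x = r. *)
Require Import Defs.
From Stdlib Require Import Reals PeanoNat Factorial.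
From Stdlib Require Import Lia.
From Coquelicot Require Import Coquelicot.
Open Scope R_scope.

(** The terms over the triangle i + j <= n are regrouped along the diagonals i + j = m. *)
Lemma sum_f_R0_triangle (g : nat -> nat -> R) (n : nat) :
  sum_f_R0 (fun i => sum_f_R0 (g i) (n - i)) n =
  sum_f_R0 (fun m => sum_f_R0 (fun i => g i (m - i)%nat) m) n.
Proof.
induction n as [|n IH]; [reflexivity|].
(* From [n] to [S n], each row i <= n gains its entry at j = [S n] - i and a new row contributes
   [g (S n) 0]; together these form the diagonal m = [S n]. *)
rewrite !(tech5 _ n), <- IH, Nat.sub_diag, <- Rplus_assoc, <- plus_sum.
apply (f_equal (fun s => s + g (S n) 0%nat)).
apply sum_eq; intros i Hi; now rewrite Nat.sub_succ_l, tech5.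
Qed.

(** Series are compared coefficient by coefficient, so replacing a factor of a product takes this
    congruence. *)
Lemma PS_mult_ext (a a' b b' : nat -> R) (n : nat) :
  (forall i, a i = a' i) -> (forall i, b i = b' i) ->
  PS_mult a b n = PS_mult a' b' n.
Proof. intros Ha Hb; apply sum_eq; intros i _; now rewrite Ha, Hb. Qed.

(** Both sides sum a_i b_j c_l over i + j + l = n, grouped by i on the left and by m = i + j on the
    right. *)
Lemma PS_mult_assoc (a b c : nat -> R) (n : nat) :
  PS_mult a (PS_mult b c) n = PS_mult (PS_mult a b) c n.
Proof.
unfold PS_mult.
transitivity
  (sum_f_R0 (fun i => sum_f_R0 (fun j => a i * b j * c (n - i - j)%nat) (n - i)) n).
- apply sum_eq; intros i _; rewrite scal_sum.
  apply sum_eq; intros j _; ring.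
- rewrite (sum_f_R0_triangle (fun i j => a i * b j * c (n - i - j)%nat)).
  apply sum_eq; intros m _; rewrite (Rmult_comm _ (c _)), scal_sum.
  apply sum_eq; intros i Hi.
  now replace (n - i - (m - i))%nat with (n - m)%nat by lia.
Qed.

Lemma PS_minusE (a b : nat -> R) (n : nat) : PS_minus a b n = a n - b n.
Proof. reflexivity. Qed.

Lemma PS_mult_minus_l (a b c : nat -> R) (n : nat) :
  PS_mult (PS_minus a b) c n = PS_mult a c n - PS_mult b c n.
Proof.
unfold PS_mult; rewrite <- minus_sum.
apply sum_eq; intros i _; rewrite PS_minusE; ring.
Qed.

Lemma PS_mult_minus_r (a b c : nat -> R) (n : nat) :
  PS_mult a (PS_minus b c) n = PS_mult a b n - PS_mult a c n.
Proof.
unfold PS_mult; rewrite <- minus_sum.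
apply sum_eq; intros i _; rewrite PS_minusE; ring.
Qed.

Lemma PS_mult_1_r (a : nat -> R) (n : nat) : PS_mult a PS_one n = a n.
Proof.
unfold PS_mult; destruct n as [|n]; [unfold PS_one; simpl; ring|].
rewrite tech5, sum_f_R0_eq0, Nat.sub_diag; [unfold PS_one; simpl; ring|].
intros i Hi; rewrite Nat.sub_succ_l by exact Hi; unfold PS_one; simpl; ring.
Qed.

(** This is the binomial theorem for (x + y)^n divided by n!. *)
Lemma PS_exp_plus (x y : R) (n : nat) :
  PS_mult (PS_exp x) (PS_exp y) n = PS_exp (x + y) n.
Proof.
unfold PS_mult, PS_exp; rewrite binomial; unfold Rdiv.
rewrite Rmult_comm, scal_sum.
apply sum_eq; intros i _; unfold Binomial.C.
field; repeat split; apply INR_fact_neq_0.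
Qed.

(** Multiplying e^(x t) by e^(t/2) or e^(-t/2) shifts x by 1/2 or -1/2, while [P] does not depend on
    x. *)
Lemma PS_exp_central_diff (P : nat -> R) (x : R) (n : nat) :
  PS_mult (PS_exp x)
    (PS_mult (PS_minus (PS_exp (1 / 2)) (PS_exp (- (1 / 2)))) P) n =
  central_diff (fun y => PS_mult (PS_exp y) P n) x.
Proof.
unfold central_diff; rewrite PS_mult_assoc, <- PS_mult_minus_l.
apply PS_mult_ext; [|reflexivity]; intros i.
now rewrite PS_mult_minus_r, PS_minusE, !PS_exp_plus.
Qed.

Lemma central_diff_iter_pow (k n : nat) (x : R) :
  central_diff_iter k (fun y => y ^ n) x =
  INR (fact n) * PS_mult (PS_exp x)
    (PS_pow (PS_minus (PS_exp (1 / 2)) (PS_exp (- (1 / 2)))) k) n.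
Proof.
(* The induction hypothesis is used at both x + 1/2 and x - 1/2. *)
revert x; induction k as [|k IH]; intros x.
- change (x ^ n = INR (fact n) * PS_mult (PS_exp x) PS_one n).
  rewrite PS_mult_1_r; unfold PS_exp; field; apply INR_fact_neq_0.
- change (PS_pow ?a (S k)) with (PS_mult a (PS_pow a k)).
  rewrite PS_exp_central_diff.
  change (central_diff_iter (S k) ?f) with (central_diff (central_diff_iter k f)).
  unfold central_diff; rewrite !IH; ring.
Qed.

Theorem theorem2p6 : forall r n k : nat,
  / INR (fact k) * central_diff_iter k (fun x : R => x ^ n) (INR r) =
  if (k <=? n)%nat then central_factorial2 r (n + r) (k + r) else 0.
Proof.
intros r n k; rewrite central_diff_iter_pow.
transitivity (INR (fact n) * central_factorial2_egf r k n).
- unfold central_factorial2_egf, PS_scal, scal; simpl; unfold mult; simpl; ring.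
(* For n >= k the factor n! cancels the denominator of the coefficient; for n < k the coefficient is
   0. *)
- rewrite central_factorial2_egfE.
  destruct (k <=? n)%nat; [field; apply INR_fact_neq_0 | ring].
Qed.
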